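(* For $k=1$ and for $k=2$, there is a finite constant $C_k$ such that $f_k(n)=\Theta(C_k^n)$ as $n\to\infty$.
   Context: A permutation $\pi:[n]\to[n]$, where $[n]=\{1,\ldots,n\}$, is $k$-convex (for an integer $k\ge 0$) if $\pi(i-1)+\pi(i+1)-2\pi(i)\le k$ for all $i\in\{2,\ldots,n-1\}$. $f_k(n)$ denotes the number of $k$-convex permutations of length $n$. $f_k(n)=\Theta(C_k^n)$ means that there are constants $c,c'>0$ with $cC_k^n\le f_k(n)\le c'C_k^n$ for all sufficiently large $n$. *)

(* Defs.v *)
From HB Require Import structures.
From mathcomp Require Import all_boot all_order all_fingroup all_algebra.
From mathcomp Require Import reals.

Set Implicit Arguments.
Unset Strict Implicit.
Unset Printing Implicit Defensive.

Import Order.TTheory GRing.Theory Num.Theory.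

Local Open Scope ring_scope.

(* Positions and values are 0-based: s : 'S_n stands for the permutation pi of
   {1, ..., n} with pi(i + 1) = s i + 1; second differences are unaffected.
   The triples (h, i, j) with h + 1 = i and i + 1 = j are exactly the
   (i - 1, i, i + 1) with i an interior position. *)
Definition kconvex (k n : nat) (s : 'S_n) : bool :=
  [forall h : 'I_n, forall i : 'I_n, forall j : 'I_n,
     (h.+1 == i :> nat) && (i.+1 == j :> nat) ==>
     ((s h : nat)%:Z + (s j : nat)%:Z - 2 * (s i : nat)%:Z <= k%:Z)].

Definition num_kconvex (k n : nat) : nat := #|[set s : 'S_n | kconvex k s]|.

Definition Theta_exp (R : realType) (f : nat -> nat) (C : R) : Prop :=
  exists c c' : R, 0 < c /\ 0 < c' /\
    exists N : nat, forall n : nat, (N <= n)%N ->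
      c * C ^+ n <= (f n)%:R <= c' * C ^+ n.

(* Main.v *)
(* For k <= 2 a descent can only be followed by a descent, so a k-convex
   permutation is unimodal and is encoded by the word telling, for each value
   below the maximum, on which side of the maximum it sits. The permutation is
   k-convex iff, on each side, consecutive gaps between the values, maximum
   included, grow by at most k. An automaton reading the word run by run
   recognises this condition.
   Let H(n) be the number of words of length n accepted from an unconstrained
   state and A(n) the number accepted from the state (k, k, k). Then
   H(m + n) <= H(m) H(n), and since two extra letters always lead to a state at
   least as good as (k, k, k), also H(m) A(n) <= H(m + n + 2). Hence for
   l = inf H(n)^(1/n) one has l^n <= H(n) and A(n) <= l^(n + 2). Finally
   H(n) = O(l^n): long runs can only be continued by single letters separated
   by long runs, and such patterns are exponentially rarer than l^n because
   l^3 > l^2 + 1, which follows from A(16) >= 1049. *)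
Require Import Defs.
From HB Require Import structures.
From mathcomp Require Import all_boot all_order all_fingroup all_algebra.
From mathcomp Require Import classical_sets reals sequences exp.
From mathcomp Require Import zify ring lra.

Set Implicit Arguments.
Unset Strict Implicit.
Unset Printing Implicit Defensive.

Import Order.TTheory GRing.Theory Num.Theory.

Local Open Scope ring_scope.

(** * Monotonicity and multiplicative inequalities for the automaton counts *)

Section Count.
Variable k : nat.
Local Open Scope nat_scope.

(* State of the automaton: r is the number of letters by which the current run can
   still be extended, e (resp. a) is the number of letters by which the next run
   (resp. the one after it) could be extended beyond its first letter if the
   switches happened immediately. *)
Fixpoint run_count (n r a e : nat) : nat :=
  if n is m.+1 then
    (if r is r'.+1 then run_count m r' a.+1 k.-1 else 0) + run_count m e k a
  else 1.

Lemma run_count_gt0 n r a e : 0 < run_count n r a e.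
Proof. by elim: n r a e => //= n IHn r a e; rewrite addn_gt0 IHn orbT. Qed.

(** Within [n] letters an entry of size at least [n] is never exhausted, hence the truncation. In
    particular the state (n, n, n) is unconstrained for words of length [n]. *)
Lemma leq_run_count n r a e r' a' e' :
    minn r n <= r' -> minn a n <= a' -> minn e n <= e' ->
  run_count n r a e <= run_count n r' a' e'.
Proof.
elim: n r a e r' a' e' => //= n IHn r a e r' a' e' hr ha he.
apply: leq_add; last by apply: IHn; lia.
case: r hr => [|r] // hr; case: r' hr => [|r'] hr; first lia.
by apply: IHn; lia.
Qed.

Lemma run_countD_le m n r a e :
  run_count (m + n) r a e <= run_count m r a e * run_count n n n n.
Proof.
elim: m r a e => [|m IHm] r a e /=; first by rewrite mul1n leq_run_count ?geq_minr.
by rewrite mulnDl leq_add //; case: r.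
Qed.

(* From any state, two switches lead to a state at least as good as (k, k, k). *)
Lemma run_count_glue m n r a e : k <= a ->
  run_count m r a e * run_count n k k k <= run_count (m + n).+2 r a e.
Proof.
elim: m r a e => [|m IHm] r a e hka.
  rewrite mul1n /=.
  apply: leq_trans (leq_addl _ _); apply: leq_trans (leq_addl _ _).
  by apply: leq_run_count; lia.
rewrite addSn /= mulnDl -/run_count leq_add //.
  by case: r => [|r] //; apply: leq_trans (IHm _ _ _ _) _; rewrite //= leqW.
exact: leq_trans (IHm _ _ _ _) _.
Qed.

End Count.

(** * Almost convex sequences and unimodality *)

Section Words.
Variable k : nat.
Local Open Scope nat_scope.

Fixpoint almost_convex (s : seq nat) : bool :=
  if s is x :: s' then
    (if s' is y :: z :: _ then x + z <= y.*2 + k else true) && almost_convex s'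
  else true.

Lemma almost_convexP s :
  reflect (forall i, i.+2 < size s ->
             nth 0 s i + nth 0 s i.+2 <= (nth 0 s i.+1).*2 + k)
          (almost_convex s).
Proof.
elim: s => [|x s IHs] /=; first by left.
apply: (iffP andP) => [[xs /IHs hs] [|i] /=|hs].
- by case: s xs {IHs hs} => [|y [|z s]].
- by rewrite ltnS => /hs.
split; last by apply/IHs => i hi; exact: (hs i.+1).
by case: s hs {IHs} => [|y [|z s]] // /(_ 0); exact.
Qed.

Lemma almost_convex_rev s : almost_convex (rev s) = almost_convex s.
Proof.
suff h t : almost_convex t -> almost_convex (rev t).
  by apply/idP/idP => /h//; rewrite revK.
move=> /almost_convexP ht; apply/almost_convexP => i; rewrite size_rev => hi.
rewrite !nth_rev; try lia.
have := ht (size t - i.+3); rewrite addnC.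
have -> : (size t - i.+3).+1 = size t - i.+2 by lia.
have -> : (size t - i.+2).+1 = size t - i.+1 by lia.
by apply; lia.
Qed.

Lemma almost_convex_cat s x y t :
  almost_convex (s ++ x :: y :: t) =
  almost_convex (s ++ [:: x; y]) && almost_convex (x :: y :: t).
Proof.
elim: s => [|a s IHs] //; rewrite !cat_cons.
have ac_cons a' s' : almost_convex (a' :: s') =
  (if s' is y :: z :: _ then a' + z <= y.*2 + k else true) && almost_convex s'.
  by [].
rewrite !(ac_cons a) {}IHs andbA; congr (_ && _ && _).
by case: s => [|b [|c s]].
Qed.

(** The triple centred at [m] has nonpositive second difference, so it never constrains anything and
    the two sides decouple. *)
Lemma almost_convex_peak s t m :
    {in s, forall x, x <= m} -> {in t, forall x, x <= m} ->
  almost_convex (s ++ m :: rev t) =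
  almost_convex (rcons s m) && almost_convex (rcons t m).
Proof.
move=> sm tm; rewrite -(almost_convex_rev (rcons t m)) rev_rcons.
case/lastP: s sm => [|s x] sm //.
rewrite cat_rcons almost_convex_cat -!cats1 -catA; congr (_ && _).
rewrite [LHS]/= -[in LHS]/(almost_convex (m :: rev t)) -[RHS]andTb; congr (_ && _).
case: (rev t) (mem_rev t) => [|z t'] // ht.
have xm : x <= m by apply: sm; rewrite mem_rcons mem_head.
have zm : z <= m by apply: tm; rewrite -ht mem_head.
lia.
Qed.

(** A next entry z satisfies z <= 2y + k - x <= y + 1. Here z = y is excluded by distinctness, and z
    = y + 1 would force x = z, so the descent goes on. *)
Lemma almost_convex_desc x y s : k <= 2 -> uniq (x :: y :: s) ->
  almost_convex (x :: y :: s) -> y < x -> path gtn x (y :: s).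
Proof.
move=> k2; elim: s x y => [|z s IHs] x y xys xys_ac yx; first by rewrite /= yx.
have zy : z < y.
  have : x + z <= y.*2 + k by case/andP: xys_ac.
  have : (x != z) && (y != z).
    by move: xys; rewrite /= !inE !negb_or => /and3P[/and3P[_ -> _] /andP[-> _]].
  lia.
have := IHs y z; rewrite /= yx zy => -> //; first by case/andP: xys.
by case/andP: xys_ac.
Qed.

(** A descent to the left of [m] would persist up to [m], contradicting maximality; to the right,
    the step leaving [m] is already a descent. *)
Lemma almost_convex_unimodal s m t : k <= 2 -> uniq (s ++ m :: t) ->
    almost_convex (s ++ m :: t) -> {in s ++ t, forall x, x < m} ->
  sorted ltn s && sorted gtn t.
Proof.
move=> k2; elim: s => [|x s IHs] /=.
  case: t => [|y t] // mt mt_ac tm.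
  have /andP[] // : path gtn m (y :: t).
  by apply: almost_convex_desc => //; apply: tm; rewrite mem_head.
move=> /andP[xs us] /andP[hxs acs] sm.
have /andP[ss ->] : sorted ltn s && sorted gtn t.
  by apply: IHs => // y ys; apply: sm; rewrite inE ys orbT.
rewrite andbT; case: s => [|y s] // in IHs xs us hxs acs sm ss *.
rewrite /= -/(sorted ltn (y :: s)) ss andbT ltnNge leq_eqVlt.
apply/negP => /orP[/eqP yx|yx]; first by rewrite yx mem_head in xs.
have : path gtn x (y :: s ++ m :: t).
  by apply: almost_convex_desc => //; rewrite /= ?xs//; apply/andP.
rewrite (path_sortedE (rev_trans ltn_trans)) => /andP[/allP/(_ m)].
rewrite -cat_cons mem_cat mem_head orbT => /(_ isT) /= mx _.
by have := sm x (mem_head _ _); rewrite ltnNge ltnW.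
Qed.

(** * Unimodal arrangements encoded by words *)

Definition letters (c : bool) (w : seq bool) (p : nat) : seq nat :=
  mask [seq d == c | d <- w] (iota p (size w)).

Lemma letters_cons c d w p :
  letters c (d :: w) p = if d == c then p :: letters c w p.+1 else letters c w p.+1.
Proof. by []. Qed.

Lemma letters_subseq c w p : subseq (letters c w p) (iota p (size w)).
Proof. exact: mask_subseq. Qed.

Lemma mem_letters c w p x : x \in letters c w p -> p <= x < p + size w.
Proof. by move/(mem_subseq (letters_subseq c w p)); rewrite mem_iota. Qed.

Lemma letters_sorted c w p : sorted ltn (letters c w p).
Proof. by apply: (sorted_mask ltn_trans); exact: iota_ltn_sorted. Qed.

Lemma perm_letters w p :
  perm_eq (letters true w p ++ letters false w p) (iota p (size w)).
Proof.
elim: w p => [|d w IHw] p //=; rewrite !letters_cons.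
case: d; rewrite /= ?perm_cons ?IHw//.
by rewrite -[p :: letters _ _ _]cat1s perm_catCA cat1s perm_cons IHw.
Qed.

Lemma letters_filter (P : pred nat) p n (w := [seq P x | x <- iota p n]) c :
  letters c w p = [seq x <- iota p n | P x == c].
Proof. by rewrite filter_mask /letters size_map size_iota -map_comp. Qed.

Lemma letters_inj w w' p : size w = size w' ->
  letters true w p = letters true w' p -> w = w'.
Proof.
elim: w w' p => [|d w IHw] [|d' w'] p //= [sww']; rewrite !letters_cons.
have np v : p \notin letters true v p.+1.
  by apply/negP => /mem_letters; rewrite ltnn.
case: d d' => [] [] /= e.
- by case: e => /IHw ->.
- by have := np w'; rewrite -e mem_head.
- by have := np w; rewrite e mem_head.
- by rewrite (IHw _ _ sww' e).
Qed.

(* [arrange w p] lists the values p, ..., p + size w of the unimodal arrangement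
   in which p + i precedes the maximum iff the i-th letter of w is [true]. *)
Definition arrange (w : seq bool) (p : nat) : seq nat :=
  letters true w p ++ (p + size w) :: rev (letters false w p).

Lemma perm_arrange w p : perm_eq (arrange w p) (iota p (size w).+1).
Proof.
rewrite /arrange -[(p + _) :: _]cat1s perm_catCA cat1s -addn1 iotaD cats1.
rewrite perm_sym perm_rcons perm_sym perm_cons.
by rewrite -(permPr (perm_letters w p)) perm_cat2l perm_rev.
Qed.

Lemma arrange_inj w w' p : size w = size w' -> arrange w p = arrange w' p -> w = w'.
Proof.
move=> sww'; rewrite /arrange sww' => e; apply: (letters_inj (p := p) sww').
have pre v u : size v = size w' ->
    letters true v p = take (index (p + size w') (letters true v p ++ (p + size w') :: u))
                            (letters true v p ++ (p + size w') :: u).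
  move=> sv; rewrite index_cat ifN; first by rewrite index_head addn0 take_size_cat.
  by apply/negP => /mem_letters; rewrite sv ltnn andbF.
by rewrite (pre w (rev (letters false w p)) sww') e -pre.
Qed.

Lemma arrange_surj l p n : k <= 2 -> perm_eq l (iota p n.+1) -> almost_convex l ->
  exists2 w, size w = n & l = arrange w p.
Proof.
move=> k2 lp l_ac.
have ul : uniq l by rewrite (perm_uniq lp) iota_uniq.
have : p + n \in l by rewrite (perm_mem lp) mem_iota; lia.
move=> /splitPr lst; case: lst lp l_ac ul => s t lp l_ac ul.
have mem_st x : x \in s ++ t = (p <= x < p + n).
  have := perm_mem lp x; rewrite mem_iota mem_cat inE mem_cat => e.
  have : (p + n \notin s) && (p + n \notin t).
    by move: ul; rewrite cat_uniq /= negb_or => /and4P[_ /andP[-> _] -> _].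
  have [->|xpn] := eqVneq x (p + n); last by move: e; rewrite (negPf xpn) /=; lia.
  by case/andP => /negPf -> /negPf ->; lia.
have st_lt : {in s ++ t, forall x, x < p + n} by move=> x; rewrite mem_st => /andP[].
have /andP[ss tt] := almost_convex_unimodal k2 ul l_ac st_lt.
exists [seq x \in s | x <- iota p n]; first by rewrite size_map size_iota.
have iota_srt P := sorted_filter ltn_trans P (iota_ltn_sorted p n).
rewrite /arrange !letters_filter size_map size_iota; congr (_ ++ _ :: _).
  apply: (irr_sorted_eq ltn_trans ltnn) => // x.
  rewrite mem_filter mem_iota -mem_st mem_cat eqb_id.
  by case: (x \in s).
apply: (can_inj revK); rewrite revK.
apply: (irr_sorted_eq ltn_trans ltnn) => //; first by rewrite rev_sorted.
move=> x; rewrite mem_rev mem_filter mem_iota -mem_st mem_cat eqbF_neg.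
case xs: (x \in s) => //=; apply/negP => xt.
by move: ul; rewrite cat_uniq => /and3P[_ /hasPn/(_ x)]; rewrite inE xt orbT xs => /(_ isT).
Qed.

(** * Gap conditions read by the automaton *)

Fixpoint gap_bounded (d x : nat) (s : seq nat) : bool :=
  if s is y :: s' then (y - x <= d) && gap_bounded (y - x + k) y s' else true.

Lemma gap_bounded_convex d x s : path ltn x s ->
  gap_bounded d x s = (head x s - x <= d) && almost_convex (x :: s).
Proof.
elim: s d x => [|y s IHs] d x; first by rewrite /= subnn.
move=> /= /andP[xy ys]; rewrite IHs//; congr (_ && _).
case: s ys {IHs} => [|z s] ys; first by rewrite /= subnn.
rewrite -[RHS]/((x + z <= y.*2 + k) && almost_convex (y :: z :: s)).
by congr (_ && _); move: ys => /= /andP[yz _]; lia.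
Qed.

(* If the values start at m, the gap m between 0 and the first of them makes the
   bounds on the first two gaps void. *)
Lemma gap_bounded_start d m s : sorted ltn s -> {in s, forall x, m <= x <= d} ->
  d <= m.*2 -> gap_bounded d 0 s = almost_convex s.
Proof.
case: s => [|y s] // ys hs dm; rewrite /= subn0 gap_bounded_convex//.
have /andP[my yd] := hs y (mem_head _ _); rewrite yd /=.
case: s ys hs => [|z s] ys hs; first by rewrite subnn.
have /andP[_ zd] : m <= z <= d by apply: hs; rewrite !inE eqxx orbT.
by rewrite (_ : head y (z :: s) - y <= y + k) //=; lia.
Qed.

Lemma gap_bounded_lt d x y s n : y - x > d -> {in rcons s n, forall z, y <= z} ->
  gap_bounded d x (rcons s n) = false.
Proof.
move=> dyx hs; case: s hs => [|z s] hs /=.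
  by have := hs n (mem_head _ _); lia.
by have := hs z (mem_head _ _); case: leqP => //; lia.
Qed.

Fixpoint accepts (r a e : nat) (c : bool) (w : seq bool) : bool :=
  if w is d :: w' then
    if d == c then (if r is r'.+1 then accepts r' a.+1 k.-1 c w' else false)
    else accepts e k a d w'
  else true.

(** Here [p] is the last value placed, on side [c], and [q] the last one on the other side; [dc] and
    [dq] bound the next gaps there. A gap on one side is one more than the length of the run on the
    other side that it spans, which gives the three entries of the state. Both sides end with the
    maximum. *)
Lemma gap_bounded_accepts q p dc dq c w : 0 < k -> q < p -> p.+1 - q <= dq -> 1 < dc ->
  gap_bounded dc p (rcons (letters c w p.+1) (p.+1 + size w)) &&
  gap_bounded dq q (rcons (letters (~~ c) w p.+1) (p.+1 + size w)) =
  accepts (dq - (p.+1 - q)) ((p - q + k).-1) dc.-2 c w.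
Proof.
move=> k_gt0; elim: w q p dc dq c => [|d w IHw] q p dc dq c qp pq dc1.
  by rewrite /= addn0 !andbT; lia.
rewrite !letters_cons [size _]/= addnS -addSn.
case: (eqVneq d c) => [->|dc'].
  rewrite [accepts _ _ _ _ _]/= eqxx (_ : c == ~~ c = false); last by case: c.
  rewrite rcons_cons [gap_bounded dc _ _]/= (_ : p.+1 - p = 1); last by lia.
  rewrite (ltnW dc1) andTb.
  case E: (dq - (p.+1 - q)) => [|r].
    (* With [p.+1] on side [c], all that remains on the other side is at least [p.+2], too far from
       [q]. *)
    rewrite [X in _ && X](@gap_bounded_lt _ _ p.+2) ?andbF//; first lia.
    move=> z; rewrite mem_rcons inE => /orP[/eqP ->|/mem_letters]; lia.
  rewrite IHw; [|lia..]; congr accepts; lia.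
have {dc'} -> : d = ~~ c by case: d c dc' => [] [].
rewrite [accepts _ _ _ _ _]/= eqxx (_ : ~~ c == c = false); last by case: c.
rewrite rcons_cons [gap_bounded dq _ _]/= pq andTb andbC.
have IH := IHw p p.+1 (p.+1 - q + k) dc (~~ c); rewrite negbK in IH.
rewrite IH; [|lia..]; congr accepts; lia.
Qed.

(** This [p] places all values between [p] and [2p], so 0 can serve as a fictitious previous value
    on both sides, with first gap bounded by [2p]. *)
Lemma arrange_accepts c w (p := (size w).+2) : 0 < k ->
  almost_convex (arrange (c :: w) p) =
  accepts (p.*2 - p.+1) (p + k).-1 (p + k).-2 c w.
Proof.
move=> k_gt0.
have le_p b : {in letters b (c :: w) p, forall x, x <= p + (size w).+1}.
  by move=> x /mem_letters /=; lia.
have gb b : almost_convex (rcons (letters b (c :: w) p) (p + (size w).+1)) =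
    gap_bounded p.*2 0 (rcons (letters b (c :: w) p) (p + (size w).+1)).
  rewrite (@gap_bounded_start _ p)//.
    have := letters_sorted b (c :: w) p; rewrite !(sorted_pairwise ltn_trans).
    rewrite pairwise_rcons => ->; rewrite andbT.
    by apply/allP => x /mem_letters /andP[].
  move=> x; rewrite mem_rcons inE => /orP[/eqP ->|/mem_letters /=]; rewrite /p; lia.
rewrite /arrange almost_convex_peak; [|exact: le_p..].
rewrite (_ : _ && _ =
  almost_convex (rcons (letters c (c :: w) p) (p + (size w).+1)) &&
  almost_convex (rcons (letters (~~ c) (c :: w) p) (p + (size w).+1))); last first.
  by case: c {le_p gb} => //; rewrite andbC.
rewrite !gb !letters_cons eqxx (_ : c == ~~ c = false); last by case: c {le_p gb}.
rewrite rcons_cons [gap_bounded p.*2 0 (p :: _)]/= subn0 addnS -addSn.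
rewrite (_ : p <= p.*2) ?andTb; last by rewrite /p; lia.
by rewrite gap_bounded_accepts ?subn0//; rewrite /p; lia.
Qed.

Fixpoint words (n : nat) : seq (seq bool) :=
  if n is m.+1 then map (cons true) (words m) ++ map (cons false) (words m)
  else [:: [::]].

Lemma mem_words n w : (w \in words n) = (size w == n).
Proof.
elim: n w => [|n IHn] [|c w] //=.
  by rewrite mem_cat; apply/orP => -[] /mapP[].
rewrite mem_cat eqSS -IHn; have ci b : injective (@cons bool b) by move=> ? ? [].
case: c; rewrite (mem_map (ci _)); [|rewrite orbC].
  by case: (w \in _) => //=; apply/mapP => -[].
by case: (w \in _) => //=; apply/mapP => -[].
Qed.

Lemma words_uniq n : uniq (words n).
Proof.
elim: n => //= n IHn; rewrite cat_uniq !map_inj_uniq ?IHn ?andbT /=.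
- by apply/hasPn => _ /mapP[w _ ->]; apply/mapP => -[].
- by move=> ? ? [].
- by move=> ? ? [].
Qed.

Lemma count_accepts n r a e c : count (accepts r a e c) (words n) = run_count k n r a e.
Proof.
elim: n r a e c => [|n IHn] r a e c //=; rewrite count_cat !count_map.
have -> : run_count k n e k a = count (accepts e k a (~~ c)) (words n) by [].
have -> : (if r is r'.+1 then run_count k n r' a.+1 k.-1 else 0) =
   count (fun w => if r is r'.+1 then accepts r' a.+1 k.-1 c w else false) (words n).
  by case: r => [|r]; rewrite ?IHn ?count_pred0.
by case: c; rewrite //= addnC.
Qed.

End Words.

(** * From permutations to words *)

Lemma kconvex_nth k n (s : 'S_n) p (l := [seq p + s i | i <- enum 'I_n]%N) :
  kconvex k s = almost_convex k l.
Proof.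
have nth_l (i : 'I_n) : nth 0%N l i = (p + s i)%N.
  by rewrite (nth_map i) ?size_enum_ord// nth_ord_enum.
have size_l : size l = n by rewrite size_map size_enum_ord.
apply/idP/almost_convexP => [ks i|hl].
  rewrite size_l => i2n; have i1n := ltnW i2n; have i0n := ltnW i1n.
  have := ks => /forallP/(_ (Ordinal i0n))/forallP/(_ (Ordinal i1n)).
  move=> /forallP/(_ (Ordinal i2n)); rewrite !eqxx /= => h.
  have := nth_l (Ordinal i0n); have := nth_l (Ordinal i1n).
  have := nth_l (Ordinal i2n) => /= -> -> ->; lia.
apply/forallP => h; apply/forallP => i; apply/forallP => j; apply/implyP.
move=> /andP[/eqP hi /eqP ij]; have := hl h; rewrite size_l hi ij ltn_ord.
by rewrite !nth_l => /(_ isT); lia.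
Qed.

Lemma perm_of_list n p (l : seq nat) : perm_eq l (iota p n) ->
  exists s : 'S_n, l = [seq p + s i | i <- enum 'I_n]%N.
Proof.
case: n => [|n] pl.
  by exists 1%g; rewrite (size0nil (perm_size pl)) (size0nil (size_enum_ord 0)).
have sl : size l = n.+1 by rewrite (perm_size pl) size_iota.
have mem_l (i : 'I_n.+1) : (p <= nth 0%N l i < p + n.+1)%N.
  by rewrite -mem_iota -(perm_mem pl) mem_nth ?sl.
pose f (i : 'I_n.+1) : 'I_n.+1 := inord (nth 0%N l i - p).
have fE i : (p + f i)%N = nth 0%N l i by rewrite inordK; have := mem_l i; lia.
have f_inj : injective f.
  move=> i j fij; apply/val_inj/eqP.
  rewrite /= -(nth_uniq 0%N (s := l)) ?sl ?(perm_uniq pl) ?iota_uniq//.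
  by rewrite -!fE fij.
exists (perm f_inj); apply: (@eq_from_nth _ 0%N).
  by rewrite size_map size_enum_ord.
move=> i; rewrite sl => i_lt.
by rewrite (nth_map (Ordinal i_lt)) ?size_enum_ord// (nth_ord_enum _ (Ordinal i_lt)) permE fE.
Qed.

Lemma num_kconvex_words k n p : (k <= 2)%N ->
  num_kconvex k n.+1 = count (fun w => almost_convex k (arrange w p)) (words n).
Proof.
move=> k2; pose word (s : 'S_n.+1) := [seq p + s i | i <- enum 'I_n.+1]%N.
have word_inj : injective word.
  have nth_word (s : 'S_n.+1) (i : 'I_n.+1) : nth 0%N (word s) i = (p + s i)%N.
    by rewrite (nth_map i) ?size_enum_ord// nth_ord_enum.
  move=> s t st; apply/permP => i; apply/val_inj/(@addnI p).
  by rewrite -!nth_word st.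
have perm_word s : perm_eq (word s) (iota p n.+1).
  have u : uniq (word s).
    by rewrite map_inj_uniq ?enum_uniq// => i j /addnI/val_inj/perm_inj.
  apply: uniq_perm (iota_uniq _ _) _ => //; apply: (uniq_min_size u _ _).2.
    move=> _ /mapP[i _ ->]; rewrite mem_iota leq_addr ltn_add2l; exact: ltn_ord.
  by rewrite size_iota size_map size_enum_ord.
rewrite /num_kconvex cardE -size_filter -(size_map word) -(size_map (arrange ^~ p)).
apply/perm_size/uniq_perm.
- by rewrite map_inj_uniq// enum_uniq.
- rewrite map_inj_in_uniq ?filter_uniq ?words_uniq// => w w'.
  rewrite !mem_filter !mem_words => /andP[_ /eqP sw] /andP[_ /eqP sw'].
  by apply: arrange_inj; rewrite sw.
move=> l; apply/mapP/mapP => -[].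
  move=> s; rewrite mem_enum inE (kconvex_nth _ _ p) -/(word s) => ac ->.
  have [w sw ws] := arrange_surj k2 (perm_word s) ac.
  by exists w => //; rewrite mem_filter mem_words sw eqxx -ws ac.
move=> w; rewrite mem_filter mem_words => /andP[ac /eqP sw] ->.
have [s ws] := perm_of_list (perm_arrange w p).
move: s ws; rewrite sw => s ws; exists s => //.
by rewrite mem_enum inE (kconvex_nth _ _ p) -ws.
Qed.

Lemma count_arrange k n c : (0 < k)%N ->
  count (fun w => almost_convex k (arrange (c :: w) n.+2)) (words n) =
  run_count k n n n n.
Proof.
move=> k_gt0.
pose acc := accepts k (n.+2.*2 - n.+3) (n.+2 + k).-1 (n.+2 + k).-2 c.
rewrite (@eq_in_count _ _ acc); last first.
  by move=> w; rewrite /acc mem_words => /eqP <-; rewrite arrange_accepts.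
(* All three entries of the initial state are at least [n], so it is equivalent to (n, n, n). *)
rewrite count_accepts; apply/eqP; rewrite eqn_leq.
by rewrite !leq_run_count //; lia.
Qed.

Lemma num_kconvex_run_count k n : (0 < k <= 2)%N ->
  num_kconvex k n.+2 = (run_count k n n n n).*2.
Proof.
move=> /andP[k_gt0 k2]; rewrite (num_kconvex_words _ n.+2 k2) /= count_cat !count_map.
by rewrite -addnn; congr (_ + _)%N; exact: count_arrange.
Qed.

(** * The exponential growth rate *)

Lemma growth_rate_exists (R : realType) (H A : nat -> nat) (d : nat) :
    (0 < d)%N -> H 0%N = 1%N -> (forall n, 0 < H n)%N -> (forall n, 0 < A n)%N ->
    (forall m n, H (m + n) <= H m * H n)%N ->
    (forall m n, H m * A n <= H (m + n + d))%N ->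
  exists2 l : R, 0 < l &
    forall n, l ^+ n <= (H n)%:R /\ (A n)%:R <= l ^+ (n + d).
Proof.
move=> d_gt0 H0 H_gt0 A_gt0 H_sub H_sup.
have HX m j : (H (m * j) <= H m ^ j)%N.
  elim: j => [|j IHj]; first by rewrite muln0 H0.
  by rewrite mulnS expnS (leq_trans (H_sub _ _))// leq_mul2l IHj orbT.
have AX n j : (A n ^ j <= H ((n + d) * j))%N.
  elim: j => [|j IHj]; first by rewrite muln0 H0.
  rewrite expnSr (leq_trans (leq_mul IHj (leqnn _)))//.
  by rewrite mulnSr addnA H_sup.
(* Logarithmic form of A(n)^m <= H((n + d)m) <= H(m)^(n + d). *)
have lnA_lnH n m : (0 < m)%N ->
    ln (A n)%:R / (n + d)%:R <= ln (H m)%:R / m%:R :> R.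
  move=> m_gt0; rewrite ler_pdivrMr ?ltr0n ?addn_gt0 ?d_gt0 ?orbT//.
  rewrite mulrAC ler_pdivlMr ?ltr0n// !mulr_natr -!lnXn ?ltr0n//.
  rewrite -!natrX ler_ln ?posrE ?ltr0n ?expn_gt0 ?A_gt0 ?H_gt0// ler_nat.
  by rewrite (leq_trans (AX n m))// mulnC HX.
pose E : set R := [set ln (H m)%:R / m%:R | m in [set m | (0 < m)%N]]%classic.
have E_neq0 : nonempty E by exists (ln (H 1%N)%:R / 1%:R); exists 1%N.
have lbE n : lbound E (ln (A n)%:R / (n + d)%:R).
  by move=> _ [m /= m_gt0 <-]; exact: lnA_lnH.
exists (expR (inf E)); first exact: expR_gt0.
move=> n; rewrite -!expRM_natl; split.
  case: n => [|n]; first by rewrite mul0r expR0 H0.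
  rewrite -ler_ln ?posrE ?expR_gt0 ?ltr0n// expRK mulrC -ler_pdivlMr ?ltr0n//.
  by apply: ge_inf; [exists (ln (A 0%N)%:R / (0 + d)%:R); exact: lbE|exists n.+1].
rewrite -ler_ln ?posrE ?expR_gt0 ?ltr0n// expRK mulrC -ler_pdivrMr.
  exact: lb_le_inf.
by rewrite ltr0n addn_gt0 d_gt0 orbT.
Qed.

(** * Upper bound of the order of l^n *)

Section Upper.
Variables (R : realType) (k : nat) (l : R).
Hypothesis k_gt0 : (0 < k)%N.
Hypothesis run_count_l : forall n, (run_count k n k k k)%:R <= l ^+ (n + 2).

(** Repeating the letter from (k, k, k) leads to (k - 1, k + 1, k - 1), which dominates this
    state. *)
Lemma run_count_low n :
  (run_count k n k.-2 k.+1 k.-1)%:R <= l ^+ (n + 3) :> R.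
Proof.
rewrite -addSnnS; apply: le_trans (run_count_l n.+1); rewrite ler_nat.
case: k k_gt0 => //= k' _; apply: leq_trans (leq_addr _ _).
by apply: leq_run_count; lia.
Qed.

(* The constants solve the linear system behind the induction; it has a positive
   solution because l^3 - l^2 - 1 > 0. *)
Lemma run_count_upper : 147 / 100 <= l -> exists C : R, 0 < C /\
  forall n r a, (run_count k n r k k)%:R <= C * l ^+ n /\
                (run_count k n r a k.-1)%:R <= C * l ^+ n.
Proof.
move=> l_ge.
have l_gt0 : 0 < l by lra.
have l_ge1 : 1 <= l by lra.
pose D := l ^+ 3 - l ^+ 2 - 1.
have D_gt0 : 0 < D.
  have l2 : 147 / 100 * (147 / 100) <= l * l by apply: ler_pM => //; lra.
  have : 147 / 100 * (147 / 100) * (47 / 100) <= l * l * (l - 1).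
    by apply: ler_pM; lra.
  rewrite /D; lra.
pose K := l ^+ 3.
have K_ge1 : 1 <= K by rewrite exprn_ege1.
(* The induction needs Y l >= X + K and X l^2 >= X l + K + Y. With [Y] as below, eliminating it
   leaves X D >= K (l + 1) + l; the summands 2 and 1 serve the base cases. *)
pose X : R := 2 + (K * (l + 1) + l) / D.
pose Y : R := (X + K) / l + 1.
have XD : X * D = 2 * D + (K * (l + 1) + l).
  by rewrite /X mulrDl divfK ?gt_eqF.
have Yl : Y * l = X + K + l by rewrite /Y mulrDl divfK ?gt_eqF// mul1r.
have X_ge2 : 2 <= X by rewrite lerDl divr_ge0 ?ltW //; nra.
have Y_ge1 : 1 <= Y by rewrite lerDr divr_ge0 ?ltW //; lra.
have Al n : (run_count k n k k k)%:R <= K * l ^+ n.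
  apply: le_trans (run_count_l n) _; rewrite addnC exprD ler_pM2r ?exprn_gt0//.
  by rewrite /K ler_weXn2l.
have Ll n : (run_count k n k.-2 k.+1 k.-1)%:R <= K * l ^+ n.
  by rewrite -exprD addnC run_count_low.
have {}main n : (forall r, (run_count k n r k k)%:R <= Y * l ^+ n) /\
    (forall r a, (run_count k n r a k.-1)%:R <= X * l ^+ n).
  elim/ltn_ind: n => -[|n] IHn.
    by split=> [r|r a]; rewrite expr0 mulr1 /=; lra.
  have [IHY IHX] := IHn n (ltnSn n).
  have ln_gt0 : 0 < l ^+ n by rewrite exprn_gt0.
  split=> [r|r a] /=; rewrite natrD exprS.
    (* From (r, k, k), repeating leads to a state bounded through [X], switching to (k, k, k). *)
    have -> : Y * (l * l ^+ n) = X * l ^+ n + K * l ^+ n + l * l ^+ n.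
      by rewrite mulrA Yl !mulrDl.
    rewrite -addrA; apply: lerD; last by apply: le_trans (Al n) _; nra.
    by case: r => [|r]; [nra|exact: IHX].
  case: n => [|n] in IHn IHY IHX ln_gt0 *.
    by rewrite /= expr0; case: r => [|r] /=; nra.
  have [{}IHY IHX'] := IHn n (ltnW (ltnSn _)).
  have lm_gt0 : 0 < l ^+ n by rewrite exprn_gt0.
  (* After a switch, repeating leads to (k - 2, k + 1, k - 1), bounded by [Ll], and switching again
     to (a, k, k), bounded through [Y]. *)
  have h1 : (run_count k n.+1 k.-1 k a)%:R <= (K + Y) * l ^+ n.
    rewrite /= natrD mulrDl; apply: lerD; last exact: IHY.
    case E : k.-1 => [|p]; first by nra.
    by apply: le_trans (Ll n); rewrite ler_nat -E; apply: leq_run_count; lia.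
  have h2 : ((if r is r'.+1 then run_count k n.+1 r' a.+1 k.-1 else 0)%N)%:R
      <= X * l ^+ n.+1.
    by case: r => [|r]; [nra|exact: IHX].
  apply: le_trans (lerD h2 h1) _; rewrite !exprS.
  suff: X * l + (K + Y) <= X * l * l by nra.
  rewrite -(ler_pM2r l_gt0).
  have -> : (X * l + (K + Y)) * l = X * l ^+ 2 + K * l + Y * l by ring.
  rewrite Yl.
  have -> : X * l * l * l = X * D + X * l ^+ 2 + X by rewrite /D; ring.
  rewrite XD; nra.
exists (X + Y); split=> [|n r a]; first lra.
have ln_gt0 : 0 < l ^+ n by rewrite exprn_gt0.
have [hY hX] := main n.
by split; [apply: le_trans (hY r) _|apply: le_trans (hX r a) _]; nra.
Qed.

(** Within two letters every path from (n, n, n) enters a state covered by [run_count_upper]: after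
    a repeat, a switch then a repeat, or two switches. These three cases give the factor 3. *)
Lemma run_count_diag_upper : 147 / 100 <= l ->
  exists2 C : R, 0 < C & forall n, (run_count k n n n n)%:R <= C * l ^+ n.
Proof.
move=> l_ge; have [C [C_gt0 hC]] := run_count_upper l_ge.
have l_ge1 : 1 <= l by lra.
have hC1 n m r a : (n <= m)%N -> (run_count k n r a k.-1)%:R <= C * l ^+ m.
  by move=> nm; apply: le_trans (hC n r a).2 _; rewrite ler_pM2l// ler_weXn2l.
have hC2 n m r e : (n <= m)%N -> (run_count k n r k e)%:R <= (C * 2) * l ^+ m.
  case: n => [|n] nm; rewrite mulrAC mulr_natr mulr2n.
    rewrite /= -[1]addr0 lerD//.
      by apply: le_trans (hC1 0 m 0 0 _)%N.
    by rewrite mulr_ge0 ?exprn_ge0 ?ltW//; lra.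
  rewrite /= natrD lerD//.
    by case: r => [|r]; [rewrite mulr_ge0 ?exprn_ge0 ?ltW//; lra|exact/hC1/ltnW].
  apply: le_trans (hC n e 0%N).1 _; rewrite ler_pM2l// ler_weXn2l//.
  exact: ltnW.
exists (C * 3); first by rewrite mulr_gt0.
case=> [|n]; first by have := hC1 0 0 0 0 isT; rewrite /= !expr0; lra.
rewrite [run_count _ _ _ _ _]/= natrD.
have h1 := hC1 n n.+1 n n.+2 (leqnSn _); have h2 := hC2 n n.+1 n.+1 n.+1 (leqnSn _).
have -> : C * 3 * l ^+ n.+1 = C * l ^+ n.+1 + C * 2 * l ^+ n.+1 by ring.
exact: lerD.
Qed.

End Upper.

Lemma run_count_Theta (R : realType) (k : nat) : k = 1%N \/ k = 2%N ->
  exists l C : R, [/\ 0 < l, 0 < C &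
    forall n, l ^+ n <= (run_count k n n n n)%:R <= C * l ^+ n].
Proof.
move=> hk; have k_gt0 : (0 < k)%N by case: hk => ->.
pose H n := run_count k n n n n; pose A n := run_count k n k k k.
have H_sub m n : (H (m + n) <= H m * H n)%N.
  have h := run_countD_le k m n (m + n) (m + n) (m + n).
  rewrite /H (leq_trans h)// leq_mul2r.
  by rewrite leq_run_count ?geq_minr ?orbT.
have H_sup m n : (H m * A n <= H (m + n + 2))%N.
  (* Gluing requires the second entry to be at least [k], which may fail for [m]; enlarging the
     entries does not change the count. *)
  rewrite {1}/H (_ : run_count k m m m m = run_count k m (m + k) (m + k) (m + k)).
    have h := run_count_glue m n (m + k) (m + k) (leq_addl m k).
    by rewrite addn2 (leq_trans h)// leq_run_count ?geq_minr.
  by apply/eqP; rewrite eqn_leq !leq_run_count //; lia.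
have [l l_gt0 hl] := growth_rate_exists R (isT : 0 < 2)%N (erefl : H 0%N = 1%N)
  (fun n => run_count_gt0 _ _ _ _ _) (fun n => run_count_gt0 _ _ _ _ _) H_sub H_sup.
(* Since 1.47^18 is about 1027, this forces l >= 1.47, just above the real root of l^3 = l^2 + 1. *)
have A16 : (1049 <= A 16)%N by rewrite /A; case: hk => ->; vm_compute.
have l_ge : 147 / 100 <= l.
  rewrite leNgt; apply/negP => l_lt.
  have : 1049%:R <= l ^+ 18 by apply: le_trans (hl 16%N).2; rewrite ler_nat.
  have : l ^+ 18 < (147 / 100) ^+ 18 by rewrite ltrXn2r// ltW.
  lra.
have [C C_gt0 hC] := run_count_diag_upper k_gt0 (fun n => (hl n).2) l_ge.
by exists l, C; split=> // n; rewrite (hl n).1 hC.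
Qed.

Theorem corollary3p13 (R : realType) (k : nat) (hk : k = 1%N \/ k = 2%N) :
  exists C : R, Theta_exp (num_kconvex k) C.
Proof.
have k12 : (0 < k <= 2)%N by case: hk => ->.
have [l [C [l_gt0 C_gt0 hl]]] := run_count_Theta R hk.
have l2_gt0 : 0 < l ^+ 2 by rewrite exprn_gt0.
exists l, (2 / l ^+ 2), (2 * C / l ^+ 2); split; first by rewrite divr_gt0.
split; first by rewrite divr_gt0 ?mulr_gt0.
exists 2%N => -[|[|n]] // _; rewrite num_kconvex_run_count// -muln2 natrM.
have divl c : c / l ^+ 2 * l ^+ n.+2 = c * l ^+ n.
  by rewrite (exprD l 2 n : l ^+ n.+2 = _) mulrA divfK ?gt_eqF.
by have /andP[h1 h2] := hl n; rewrite !divl; apply/andP; split; lra.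
Qed.
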